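(* Let $p$ be a prime and let $G$ be an infinite Hausdorff Abelian topological group in which every nonzero element has order $p$. Then $G$ contains an infinite subgroup $M$ such that $M$, endowed with the topology induced from $G$, is maximally almost periodic.
   Context: An elementary Abelian topological group is an Abelian topological group in which all nonzero elements have the same prime order $p$. A continuous character of a topological group $M$ is a continuous homomorphism from $M$ to the circle group $\mathbb T$. The von Neumann kernel $n(M)$ is the intersection of the kernels of all continuous characters of $M$. The group $M$ is maximally almost periodic if $n(M)$ is trivial. *)

(* Defs.v *)
From HB Require Import structures.
From mathcomp Require Import all_boot all_order all_algebra.
From mathcomp Require Import complex.
From mathcomp Require Import boolp classical_sets functions cardinality reals.
From mathcomp Require Import topology normedtype.

Set Implicit Arguments.
Unset Strict Implicit.
Unset Printing Implicit Defensive.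

Import GRing.Theory Num.Theory.
Import numFieldTopology.Exports.

Local Open Scope classical_set_scope.
Local Open Scope ring_scope.

Definition has_order (G : zmodType) (x : G) (n : nat) : Prop :=
  [/\ (0 < n)%N, x *+ n = 0 &
      forall m : nat, (0 < m)%N -> (m < n)%N -> x *+ m <> 0].

(* [zmodClosed G] is the type of the subgroups of [G]; [subgroup S] is the
   carrier of [S] with the induced group structure and topology. *)
Definition subgroup (G : topologicalZmodType) (S : zmodClosed G) : Type :=
  {x : G | x \in S}.

Section Subgroup.
Variables (G : topologicalZmodType) (S : zmodClosed G).

HB.instance Definition _ := [isSub of subgroup S for @sval G _].
HB.instance Definition _ := [Choice of subgroup S by <:].
HB.instance Definition _ := [SubChoice_isSubZmodule of subgroup S by <:].
HB.instance Definition _ :=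
  Topological.copy (subgroup S) (initial_topology (\val : subgroup S -> G)).

Lemma subgroup_val_continuous : continuous (\val : subgroup S -> G).
Proof. exact: initial_continuous. Qed.

Lemma subgroup_sub_continuous :
  continuous (fun x : subgroup S * subgroup S => x.1 - x.2).
Proof.
apply: continuous_comp_initial => -[x y].
have -> : \val \o (fun z : subgroup S * subgroup S => z.1 - z.2) =
    (fun z => \val z.1 - \val z.2) by apply/funext => z; rewrite [LHS]/comp raddfB.
apply: (@continuous_comp _ _ _
  (fun z : subgroup S * subgroup S => (\val z.1, \val z.2))
  (fun z : G * G => z.1 - z.2)); last exact: sub_continuous.
apply: cvg_pair; apply: continuous_comp;
  [exact: cvg_fst|exact: subgroup_val_continuous
  |exact: cvg_snd|exact: subgroup_val_continuous].
Qed.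

HB.instance Definition _ :=
  PreTopologicalNmodule_isTopologicalZmodule.Build (subgroup S)
    subgroup_sub_continuous.

End Subgroup.

Definition circle (R : realType) : set R[i] := [set z | `|z| = 1].

(* The circle group is multiplicative, hence a homomorphism into it turns sums
   into products. [R[i]^o] is [R[i]] with the topology of the modulus. *)
Definition continuous_character (R : realType) (M : topologicalZmodType)
    (chi : M -> R[i]) : Prop :=
  [/\ forall x, circle (chi x),
      forall x y, chi (x + y) = chi x * chi y &
      continuous (chi : M -> R[i]^o)].

Definition von_Neumann_kernel (R : realType) (M : topologicalZmodType) :
    set M :=
  [set x | forall chi : M -> R[i], continuous_character chi -> chi x = 1].
Arguments von_Neumann_kernel : clear implicits.

Definition maximally_almost_periodic (R : realType) (M : topologicalZmodType) :
    Prop :=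
  von_Neumann_kernel R M = [set 0].

(* Main.v *)
(* If G is not discrete, choose nonzero e_n and neighbourhoods U_n of 0 such
   that <e_n> + U_{n+1} lies in U_n and U_n - U_n meets the finite group
   S_n = <e_0, ..., e_{n-1}> only in 0.  If a combination x of the e_i lies in
   U_n, then so does its part of index >= n, hence the part of index < n lies in
   (U_n - U_n) and in S_n, and vanishes.  Thus every coefficient functional is
   continuous on M = <e_0, e_1, ...>, and composing it with an embedding of Z/p
   in the circle gives characters that separate the points of M.  If G is
   discrete, linear independence of the e_n is enough. *)
Require Import Defs.
From HB Require Import structures.
From mathcomp Require Import all_boot all_order all_algebra.
From mathcomp Require Import complex.
From mathcomp Require Import boolp classical_sets functions cardinality reals.
From mathcomp Require Import topology normedtype.

Set Implicit Arguments.
Unset Strict Implicit.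
Unset Printing Implicit Defensive.

Import GRing.Theory Num.Theory.

Local Open Scope classical_set_scope.
Local Open Scope ring_scope.

Lemma zmodClosed_of_set (G : zmodType) (A : set G) :
  A 0 -> (forall x y, A x -> A y -> A (x - y)) ->
  exists M : zmodClosed G, forall x, x \in M <-> A x.
Proof.
move=> A0 AB; pose P : {pred G} := fun x => `[< A x >].
have P_closed : zmod_closed P.
  split=> [|x y /asboolP Ax /asboolP Ay]; first exact/asboolP.
  by apply/asboolP; exact: AB.
pose M : zmodClosed G :=
  HB.pack_for (zmodClosed G) (P : G -> bool) (GRing.isZmodClosed.Build G P P_closed).
by exists M => x; split=> /asboolP.
Qed.

(** A root z of 1 + X + ... + X^(p-1) satisfies z^p = 1, and z is not 1 because p is nonzero in F;
    its order divides p, hence equals p. *)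
Lemma root_of_unity_dvdz (F : numClosedFieldType) (p : nat) :
  prime p -> exists z : F, forall a : int, z ^ a = 1 <-> (p %| a)%Z.
Proof.
move=> p_pr.
have p1_gt0 : (0 < p.-1)%N by rewrite -subn1 subn_gt0 prime_gt1.
have [z zE] := @solve_monicpoly F _ (fun=> -1) p1_gt0.
have sum0 : \sum_(i < p) z ^+ i = 0.
  rewrite -(prednK (prime_gt0 p_pr)) big_ord_recr /= zE.
  by rewrite -big_split big1 //= => i _; rewrite mulN1r subrr.
have z_neq1 : z != 1.
  apply/eqP => z1; move: sum0; rewrite z1.
  rewrite (eq_bigr (fun=> 1)) => [|i _]; last exact: expr1n.
  rewrite sumr_const card_ord => /eqP; rewrite pnatr_eq0.
  by rewrite (gtn_eqF (prime_gt0 p_pr)).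
have zp : z ^+ p = 1 by apply/eqP; rewrite -subr_eq0 subrX1 sum0 mulr0.
have [m m_prim m_dvd] := prim_order_exists (prime_gt0 p_pr) zp.
have mp : m = p.
  have [_ /(_ m m_dvd)/orP[/eqP m1|/eqP//]] := primeP p_pr.
  by move: z_neq1; rewrite -[z]expr1 -m1 (prim_expr_order m_prim) eqxx.
move: m_prim; rewrite mp => z_prim.
exists z => -[n|n].
  by rewrite dvdzE /= (prim_order_dvd z_prim); split=> /eqP.
(* The negative case: [Negz n] is -(n+1). *)
rewrite dvdzE /= (prim_order_dvd z_prim) -[z ^ _]/((z ^+ n.+1)^-1).
split=> [zn|/eqP zn]; last by rewrite zn invr1.
by rewrite -[X in X == _]invrK zn invr1.
Qed.

(** * Integer multiples modulo p *)

Section ElementaryGroup.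
Variables (p : nat) (G : zmodType).
Hypothesis p_prime : prime p.
Hypothesis G_order : forall x : G, x <> 0 -> has_order x p.

Lemma mulrz_eq0_dvdz (x : G) (a : int) : x *~ a = 0 <-> x = 0 \/ (p %| a)%Z.
Proof.
have [->|/eqP x0] := eqVneq x 0; first by rewrite mul0rz; split=> // _; left.
have [_ xp xm] := G_order x0; split=> [xa0|[//|/dvdzP[b ->]]]; last first.
  by rewrite mulrC mulrzA -pmulrn xp mul0rz.
right; have p0 : p%:Z != 0 by rewrite eqz_nat -lt0n prime_gt0.
have := modz_ge0 a p0; have := ltz_pmod a (_ : 0 < p%:Z).
rewrite ltz_nat prime_gt0 // => /(_ isT).
(* The remainder of a also kills x and is less than p, so minimality of the order forces it to be
   0. *)
have : x *~ (a %% p)%Z = 0.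
  by rewrite /modz mulrzBr xa0 mulrC mulrzA -pmulrn xp mul0rz subr0.
move=> xr rp r0; apply/dvdz_mod0P; move: xr rp r0.
case: (a %% p)%Z => // -[//|r] /= xr rp _.
by have /(_ xr) := xm r.+1 isT rp.
Qed.

(** Bezout: if p does not divide a, then u p + v a = 1 makes e a multiple of [e *~ a]. *)
Lemma mulrz_mem_dvdz (S : zmodClosed G) (e : G) (a : int) :
  e \notin S -> e *~ a \in S -> (p %| a)%Z.
Proof.
move=> eS eaS; apply: contraNT eS => pa.
have : coprimez p a.
  by rewrite coprimezE /= prime_coprime // -dvdzE.
move=> /coprimezP[[u v] /= uv]; rewrite -[e]mulr1z -uv mulrzDr.
rewrite [_ *~ (u * p)](_ : _ = 0) ?add0r; last first.
  by apply/mulrz_eq0_dvdz; right; rewrite dvdz_mull.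
by rewrite mulrC mulrzA rpredMz.
Qed.

(** Integer coefficients, compared modulo p, stand for elements of Z/p; one sequence [c] serves
    every length n. *)
Definition lincomb (e : nat -> G) (c : nat -> int) (n : nat) : G :=
  \sum_(i < n) e i *~ c i.

Lemma lincombD e c d n :
  lincomb e (fun i => c i + d i) n = lincomb e c n + lincomb e d n.
Proof. by rewrite -big_split; apply: eq_bigr => i _; rewrite mulrzDr. Qed.

Lemma lincombB e c d n :
  lincomb e (fun i => c i - d i) n = lincomb e c n - lincomb e d n.
Proof. by rewrite -sumrB; apply: eq_bigr => i _; rewrite mulrzBr. Qed.

End ElementaryGroup.

(** * Neighbourhoods of zero *)

Section NeighborhoodsOfZero.
Variable G : topologicalZmodType.

Lemma nbhs0_add (U : set G) : nbhs 0 U ->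
  exists V : set G, nbhs 0 V /\ forall u v, V u -> V v -> U (u + v).
Proof.
move=> U0; have := @add_continuous G (0, 0) U; rewrite /= addr0.
move=> /(_ U0)[[A B] /= [A0 B0] AB].
exists (A `&` B); split; first exact: filterI.
by move=> u v [Au _] [_ Bv]; exact: (AB (u, v)).
Qed.

Lemma nbhs0_sub (U : set G) : nbhs 0 U ->
  exists V : set G, nbhs 0 V /\ forall u v, V u -> V v -> U (u - v).
Proof.
move=> U0; have := @sub_continuous G (0, 0) U; rewrite /= subr0.
move=> /(_ U0)[[A B] /= [A0 B0] AB].
exists (A `&` B); split; first exact: filterI.
by move=> u v [Au _] [_ Bv]; exact: (AB (u, v)).
Qed.

Lemma nbhs0_mulrn (U : set G) (n : nat) : nbhs 0 U ->
  \forall x \near (0 : G), U (x *+ n).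
Proof.
elim: n U => [|n IHn] U U0.
  by apply: nearW => x; rewrite mulr0n; exact: nbhs_singleton.
have [V [V0 VU]] := nbhs0_add U0.
by near=> x; rewrite mulrS; apply: VU; near: x; [exact: V0|exact: IHn].
Unshelve. all: by end_near. Qed.

Lemma subgroup_nbhs_translate (S : zmodClosed G) (x : subgroup S) (W : set G) :
  nbhs 0 W -> nbhs x [set y : subgroup S | W (val y - val x)].
Proof.
have valB_continuous : continuous (fun y : subgroup S => val y - val x).
  move=> y; apply: (@continuous_comp _ _ _
    (fun y : subgroup S => (val y, val x)) (fun u : G * G => u.1 - u.2)).
    apply: cvg_pair;
      [exact: nbhs_filter|exact: subgroup_val_continuous|apply: cvg_cst; exact: nbhs_filter].
  exact: sub_continuous.
by move=> W0; apply: valB_continuous; rewrite subrr.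
Qed.

End NeighborhoodsOfZero.

(* The e_i are independent over Z/p and, for every k, the k-th coefficient is a
   continuous function on the subgroup that they generate. *)
Definition topologically_independent (p : nat) (G : topologicalZmodType)
    (e : nat -> G) : Prop :=
  forall k, exists W : set G, nbhs 0 W /\
    forall n c, (k < n)%N -> W (lincomb e c n) -> (p %| c k)%Z.

(** * Characters on the span of an independent sequence *)

Section MaximallyAlmostPeriodic.
Variables (R : realType) (p : nat) (G : topologicalZmodType) (e : nat -> G).
Hypothesis p_prime : prime p.
Hypothesis G_order : forall x : G, x <> 0 -> has_order x p.
Hypothesis e_indep : topologically_independent p e.

(** Asking for all large n lets sums and differences be formed without matching lengths. *)
Definition coordinates (x : G) (c : nat -> int) : Prop :=
  \forall n \near \oo, x = lincomb e c n.

Lemma coordinatesD x y c d : coordinates x c -> coordinates y d ->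
  coordinates (x + y) (fun i => c i + d i).
Proof.
by move=> xc yd; near=> n; rewrite lincombD; congr (_ + _); near: n.
Unshelve. all: by end_near. Qed.

Lemma coordinatesB x y c d : coordinates x c -> coordinates y d ->
  coordinates (x - y) (fun i => c i - d i).
Proof.
by move=> xc yd; near=> n; rewrite lincombB; congr (_ - _); near: n.
Unshelve. all: by end_near. Qed.

Lemma coordinates_basis k : coordinates (e k) (fun i => (i == k)%:Z).
Proof.
exists k.+1 => // n /= kn; rewrite /lincomb (bigD1 (Ordinal kn)) //= eqxx mulr1z.
rewrite big1 ?addr0 // => i; rewrite -val_eqE /= => /negPf ->.
by rewrite mulr0z.
Qed.

Lemma coordinates_near k : exists W : set G, nbhs 0 W /\
  forall x y c d, coordinates x c -> coordinates y d -> W (y - x) ->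
    (p %| d k - c k)%Z.
Proof.
have [W [W0 We]] := e_indep k; exists W; split=> // x y c d xc yd Wyx.
have [N _ yxE] := coordinatesB yd xc.
(* From N on the expansion of y - x is valid; [k.+1] ensures that index k occurs in it. *)
apply: (We (maxn N k.+1) (fun i => d i - c i)); first exact: leq_maxr.
by rewrite -yxE //= leq_maxl.
Qed.

Lemma coordinates_modp k x c d : coordinates x c -> coordinates x d ->
  (p %| d k - c k)%Z.
Proof.
move=> xc xd; have [W [W0 We]] := coordinates_near k.
by apply: (We x x) => //; rewrite subrr; exact: nbhs_singleton.
Qed.

Lemma coordinates_dvdz_eq0 x c : coordinates x c ->
  (forall k, (p %| c k)%Z) -> x = 0.
Proof.
move=> [N _ xE] pc; rewrite (xE N) /=; last exact: leqnn.
by rewrite /lincomb big1 // => i _; apply/(mulrz_eq0_dvdz p_prime G_order); right.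
Qed.

Lemma maximally_almost_periodic_span :
  exists M : zmodClosed G, infinite_set [set: subgroup M] /\
    maximally_almost_periodic R (subgroup M).
Proof.
have [||M ME] := @zmodClosed_of_set G (fun x => exists c, coordinates x c).
- by exists (fun=> 0); near=> n; rewrite /lincomb big1.
- by move=> x y [c xc] [d yd]; exists (fun i => c i - d i); exact: coordinatesB.
have /choice[rep repP] : forall x : subgroup M, exists c, coordinates (val x) c.
  by move=> x; apply/ME; exact: valP.
have [z zP] := @root_of_unity_dvdz R[i] p p_prime.
have zp : z ^+ p = 1 by have [_] := zP p; apply; exact: dvdzz.
have z_neq0 : z != 0.
  apply: contra_eq_neq zp => ->.
  by rewrite expr0n (gtn_eqF (prime_gt0 p_prime)) eq_sym oner_eq0.
have z_modp a b : (p %| a - b)%Z -> z ^ a = z ^ b.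
  by move=> /zP zab; rewrite -(subrK b a) expfzDr // zab mul1r.
have normz : `|z| = 1.
  apply/eqP; rewrite -(pexpr_eq1 (prime_gt0 p_prime)) //.
  by rewrite -normrX zp normr1.
(* [rep] is an arbitrary choice of coordinates, but they are unique modulo p and z ^ a depends only
   on a modulo p. *)
pose chi k (x : subgroup M) : R[i] := z ^ rep x k.
have chiP k : continuous_character (chi k).
  split=> [x|x y|x].
  - rewrite /circle /= /chi; case: (rep x k) => n.
      by rewrite normrX normz expr1n.
    by rewrite normfV normrX normz expr1n invr1.
  - rewrite /chi -expfzDr //; apply: z_modp.
    exact: (coordinates_modp k (coordinatesD (repP x) (repP y)) (repP (x + y))).
  - have [W [W0 We]] := coordinates_near k.
    (* [chi k] is locally constant: it takes the value [chi k x] on all of x + W. *)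
    apply: cvg_near_cst; first exact: nbhs_filter.
    apply: filterS (subgroup_nbhs_translate x W0) => y Wyx; apply: z_modp.
    exact: (We _ _ _ _ (repP x) (repP y)).
exists M; split.
  have eM k : e k \in M by apply/ME; eexists; exact: coordinates_basis.
  pose f k : subgroup M := exist _ (e k) (eM k).
  move=> fin; apply: infinite_nat; rewrite -(preimage_setT f).
  (* If e_i = e_j with i and j distinct, the i-th coordinates 1 and 0 would agree modulo p. *)
  apply: finite_preimage => // i j _ _ /(congr1 val) /= eij.
  apply/eqP; apply: contraT => ij.
  have := coordinates_basis i; rewrite eij.
  move=> /coordinates_modp-/(_ i _ (coordinates_basis j)).
  rewrite eqxx (negPf ij) sub0r dvdzE /= dvdn1 => /eqP p1.
  by move: p_prime; rewrite p1.
apply/seteqP; split=> x /= => [chi1|-> chi' [chi_circle chiD _]].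
  apply: val_inj; apply: (coordinates_dvdz_eq0 (repP x)) => k.
  by apply/zP; exact: (chi1 (chi k) (chiP k)).
have chi0 : chi' 0 != 0.
  by rewrite -normr_eq0 chi_circle oner_eq0.
by apply: (mulfI chi0); rewrite -chiD addr0 mulr1.
Unshelve. all: by end_near. Qed.

End MaximallyAlmostPeriodic.

(** * Construction of a topologically independent sequence *)

Section ElementaryTopologicalGroup.
Variables (p : nat) (G : topologicalZmodType).
Hypothesis p_prime : prime p.
Hypothesis G_infinite : infinite_set [set: G].
Hypothesis G_hausdorff : hausdorff_space G.
Hypothesis G_order : forall x : G, x <> 0 -> has_order x p.

Lemma mulrz_modz (x : G) (a : int) : x *~ a = x *+ `|(a %% p)%Z|.
Proof.
have -> : x *~ a = x *~ ((a %/ p)%Z * p) + x *~ (a %% p)%Z.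
  by rewrite -mulrzDr -divz_eq.
have -> : x *~ ((a %/ p)%Z * p) = 0.
  by apply/(mulrz_eq0_dvdz p_prime G_order); right; rewrite dvdz_mull.
by rewrite add0r pmulrn gez0_abs // modz_ge0 // eqz_nat -lt0n prime_gt0.
Qed.

Lemma absz_modz_lt (a : int) : (`|(a %% p)%Z| < p)%N.
Proof.
have p_gt0 := prime_gt0 p_prime.
rewrite -ltz_nat gez0_abs; first exact: ltz_pmod.
by rewrite modz_ge0 // eqz_nat -lt0n.
Qed.

(** Only p distinct multiples of x need checking, so a finite intersection of neighbourhoods
    suffices. *)
Lemma nbhs0_mulrz (U : set G) : nbhs 0 U ->
  \forall x \near (0 : G), forall a : int, U (x *~ a).
Proof.
move=> U0; have : \forall x \near (0 : G), forall i : 'I_p, U (x *+ i).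
  by apply: filter_forall => i; exact: nbhs0_mulrn.
apply: filterS => x Ux a; rewrite mulrz_modz.
exact: (Ux (Ordinal (absz_modz_lt a))).
Qed.

Definition adjoin_spec (S : zmodClosed G) (e : G) (S' : zmodClosed G) : Prop :=
  forall x, x \in S' <-> exists y a, y \in S /\ x = y + e *~ a.

Lemma adjoin_exists (S : zmodClosed G) (e : G) : exists S', adjoin_spec S e S'.
Proof.
apply: zmodClosed_of_set => [|x y [u [a [uS ->]]] [v [b [vS ->]]]].
  by exists 0, 0; rewrite rpred0 mulr0z addr0.
exists (u - v), (a - b); split; first exact: rpredB.
by rewrite mulrzBr addrACA opprD.
Qed.

Lemma adjoin_finite (S S' : zmodClosed G) (e : G) :
  finite_set [set x | x \in S] -> adjoin_spec S e S' ->
  finite_set [set x | x \in S'].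
Proof.
move=> S_fin S'E.
apply: sub_finite_set (finite_image2 (fun y n => y + e *+ n) S_fin (finite_II p)).
move=> x /S'E[y [a [yS ->]]]; exists y => //; exists `|(a %% p)%Z|%N.
  exact: absz_modz_lt.
by rewrite mulrz_modz.
Qed.

(** Equivalently, the quotient map G -> G/S is injective on U. *)
Definition separated (S : zmodClosed G) (U : set G) : Prop :=
  forall u v, U u -> U v -> u - v \in S -> u = v.

(** In a Hausdorff group the finite set S minus 0 is closed, so some U has U - U inside its
    complement. *)
Lemma separated_exists (S : zmodClosed G) : finite_set [set x | x \in S] ->
  exists U : set G, nbhs 0 U /\ separated S U.
Proof.
move=> S_fin; have S0_closed : closed ([set x | x \in S] `\ 0).
  by apply: (accessible_finite_set_closed.1 (hausdorff_accessible G_hausdorff));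
    exact: finite_setD.
have : nbhs (0 : G) (~` ([set x | x \in S] `\ 0)).
  by apply: open_nbhs_nbhs; split; [exact: closed_openC|move=> [_]; exact].
move=> /nbhs0_sub[U [U0 UB]]; exists U; split=> // u v Uu Uv uvS.
apply/eqP; rewrite -subr_eq0; apply/eqP; apply: contrapT => uv0.
by apply: (UB u v Uu Uv); split.
Qed.

Definition stage (s : zmodClosed G * set G) : Prop :=
  [/\ finite_set [set x | x \in s.1], nbhs 0 s.2 & separated s.1 s.2].

(** One step from (S_n, U_n) to (S_{n+1}, U_{n+1}) with e = e_n; the first disjunct is the discrete
    case. *)
Definition extends (s : zmodClosed G * set G) (e : G) (s' : zmodClosed G * set G) :
    Prop :=
  [/\ adjoin_spec s.1 e s'.1,
      forall a : int, e *~ a \in s.1 -> (p %| a)%Z &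
      nbhs (0 : G) [set 0] \/ forall u (a : int), s'.2 u -> s.2 (u + e *~ a)].

Lemma stage_extends s : stage s -> exists e s', stage s' /\ extends s e s'.
Proof.
move: s => [S U] [/= S_fin U0 S_sep].
have [e [V [V0 eS eV]]] : exists e (V : set G), [/\ nbhs 0 V,
    forall a : int, e *~ a \in S -> (p %| a)%Z &
    nbhs (0 : G) [set 0] \/ forall u (a : int), V u -> U (u + e *~ a)].
  have [discrete|nondiscrete] := pselect (nbhs (0 : G) [set 0]).
    have [e [_ /= /negP eS]] := infinite_setN0 (infinite_setD G_infinite S_fin).
    exists e, U; split=> // [a|]; last by left.
    exact: (mulrz_mem_dvdz p_prime G_order).
  have [V [V0 VU]] := nbhs0_add U0.
  have eW := nbhs0_mulrz V0.
  (* The points whose multiples all lie in V form a neighbourhood of 0, which is not {0}. *)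
  have [e [eV e0]] : exists e : G, (forall a : int, V (e *~ a)) /\ e <> 0.
    apply: contrapT => no_e; apply: nondiscrete.
    apply: filterS eW => x xV; apply: contrapT => x0.
    by apply: no_e; exists x.
  exists e, V; split=> // [a eaS|]; last by right=> u a Vu; exact: VU.
  have U00 := nbhs_singleton U0.
  have Uea : U (e *~ a).
    by rewrite -[_ *~ a]add0r; apply: VU => //; exact: nbhs_singleton.
  (* Both [e *~ a] and 0 lie in U and their difference lies in S, so separation identifies them. *)
  have : e *~ a = 0 by apply: S_sep => //; rewrite subr0.
  by move=> /(mulrz_eq0_dvdz p_prime G_order)[].
have [S' S'E] := adjoin_exists S e.
have S'_fin := adjoin_finite S_fin S'E.
have [U' [U'0 U'_sep]] := separated_exists S'_fin.
exists e, (S', U' `&` V); split; split=> //=.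
- exact: filterI.
- by move=> u v [Uu _] [Uv _]; exact: U'_sep.
- by case: eV => [|eV]; [left|right=> u a [_]; exact: eV].
Qed.

Lemma topologically_independent_exists :
  exists e : nat -> G, topologically_independent p e.
Proof.
have [S0 S0E] : exists S : zmodClosed G, forall x, x \in S <-> [set 0] x.
  by apply: zmodClosed_of_set => // x y -> ->; rewrite subr0.
have S0_fin : finite_set [set x | x \in S0].
  by apply: sub_finite_set (finite_set1 (0 : G)) => x /S0E.
have [U0 [U00 U0_sep]] := separated_exists S0_fin.
pose X := {s : zmodClosed G * set G | stage s}.
have [f [_ fR]] : {f : nat -> X |
    f 0%N = exist _ (S0, U0) (And3 S0_fin U00 U0_sep) /\
    forall n, exists e, extends (sval (f n)) e (sval (f n.+1))}.
  apply: (@dependent_choice X (fun s s' => exists e, extends (sval s) e (sval s'))).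
  move=> [s s_stage]; apply: cid.
  have [e [s' [s'_stage ss']]] := stage_extends s_stage.
  by exists (exist _ s' s'_stage), e.
have /choice[e eP] := fR.
pose S n := (sval (f n)).1; pose U n := (sval (f n)).2.
have stageP n : stage (S n, U n).
  by rewrite /S /U -surjective_pairing; exact: (svalP (f n)).
have lincombS c n : lincomb e c n.+1 = lincomb e c n + e n *~ c n.
  by rewrite /lincomb big_ord_recr.
have lincomb_mem c n : lincomb e c n \in S n.
  elim: n => [|n IHn]; first by rewrite /lincomb big_ord0 rpred0.
  have [SE _ _] := eP n; apply/SE; exists (lincomb e c n), (c n).
  by rewrite lincombS.
(* Peel off the last term: it lies in S_n, so p divides its coefficient, the term vanishes and
   induction applies. *)
have lincomb_eq0 c n : lincomb e c n = 0 -> forall i, (i < n)%N -> (p %| c i)%Z.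
  elim: n => [//|n IHn]; rewrite lincombS => L0.
  have pcn : (p %| c n)%Z.
    have [_ eS _] := eP n; apply: eS.
    have -> : e n *~ c n = - lincomb e c n.
      by apply/eqP; rewrite -addr_eq0 addrC L0.
    by rewrite rpredN; exact: lincomb_mem.
  have en0 : e n *~ c n = 0 by apply/(mulrz_eq0_dvdz p_prime G_order); right.
  move: L0; rewrite en0 addr0 => /IHn pc i.
  by rewrite ltnS leq_eqVlt => /orP[/eqP->//|]; exact: pc.
exists e => k.
have [discrete|nondiscrete] := pselect (nbhs (0 : G) [set 0]).
  by exists [set 0]; split=> // n c kn L0; exact: (lincomb_eq0 c n).
have [_ Uk0 Uk_sep] := stageP k.+1.
(* The index is [k.+1] because the head of the sum must contain e_k. *)
exists (U k.+1); split=> // n c kn ULn; apply: (lincomb_eq0 c k.+1) => //.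
(* Induction with m varying: the tail from m + 1 lies in U_{m+1}, and adding a multiple of e_m lands
   in U_m. *)
have tail d m : U m (lincomb e c (m + d) - lincomb e c m).
  elim: d m => [|d IHd] m.
    by rewrite addn0 subrr; have [_ Um0 _] := stageP m; exact: nbhs_singleton.
  have [_ _ [//|eU]] := eP m.
  have := eU _ (c m) (IHd m.+1).
  by rewrite lincombS addSnnS opprD addrA subrK.
(* The sum and its tail lie in U_{k+1} and differ by the head, an element of S_{k+1}; so the head is
   0. *)
have : lincomb e c n = lincomb e c n - lincomb e c k.+1.
  apply: Uk_sep => //; last by rewrite opprB addrC subrK; exact: lincomb_mem.
  by rewrite -(subnKC kn); exact: tail.
by move=> /eqP; rewrite eq_sym subr_eq addrC -subr_eq subrr eq_sym => /eqP.
Qed.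

End ElementaryTopologicalGroup.

Theorem theorem1 (R : realType) (p : nat) (G : topologicalZmodType)
    (p_prime : prime p)
    (G_infinite : infinite_set [set: G])
    (G_hausdorff : hausdorff_space G)
    (G_order : forall x : G, x <> 0 -> has_order x p) :
  exists M : zmodClosed G,
    infinite_set [set: subgroup M] /\
    maximally_almost_periodic R (subgroup M).
Proof.
have [e e_indep] :=
  topologically_independent_exists p_prime G_infinite G_hausdorff G_order.
exact: (maximally_almost_periodic_span R p_prime G_order e_indep).
Qed.
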